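(* For any monoid $M$, the set $\mathscr L(M)=\{\mathbb O(M),\mathbb E(M),\mathbb G(M),\mathbb G_L(M),\mathbb G_R(M),\mathbb G_{LR}(M),\mathbb F(M),\mathbb F_L(M),\mathbb F_R(M),\mathbb F_{LR}(M),\mathbb I(M)\}$ is a finite $\vee$-subsemilattice of $\operatorname{Sub}(M)$, with top element $\mathbb I(M)=M$ and bottom element $\mathbb O(M)=\{1\}$. Consequently, $\mathscr L(M)$ (ordered by inclusion) is a lattice.
   Context: Submonoids of a monoid $M$ contain its identity $1$. $\operatorname{Sub}(M)$ is the lattice of all submonoids of $M$, with meet $S\wedge T=S\cap T$ and join $S\vee T=\langle S\cup T\rangle$, where $\langle A\rangle$ denotes the submonoid generated by $A$. An element $x\in M$ is a left unit if $ax=1$ for some $a\in M$, a right unit if $xa=1$ for some $a\in M$. Define: $\mathbb O(M)=\{1\}$; $\mathbb I(M)=M$; $\mathbb E(M)$ is generated by all idempotents of $M$; $\mathbb G_L(M)$ is the set of left units; $\mathbb G_R(M)$ the set of right units; $\mathbb G(M)=\mathbb G_L(M)\cap\mathbb G_R(M)$; $\mathbb G_{LR}(M)=\langle\mathbb G_L(M)\cup\mathbb G_R(M)\rangle$; $\mathbb F(M)=\langle\mathbb E(M)\cup\mathbb G(M)\rangle$; $\mathbb F_L(M)=\langle\mathbb E(M)\cup\mathbb G_L(M)\rangle$; $\mathbb F_R(M)=\langle\mathbb E(M)\cup\mathbb G_R(M)\rangle$; $\mathbb F_{LR}(M)=\langle\mathbb E(M)\cup\mathbb G_L(M)\cup\mathbb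 G_R(M)\rangle$. *)

(* Defs.v *)
From HB Require Import structures.
From mathcomp Require Import all_boot all_order.
From mathcomp Require Import boolp classical_sets cardinality.

Set Implicit Arguments.
Unset Strict Implicit.
Unset Printing Implicit Defensive.

Import Order.TTheory.
Local Open Scope classical_set_scope.
Local Open Scope group_scope.

Definition is_submonoid (M : monoidType) (S : set M) : Prop :=
  S 1 /\ forall x y, S x -> S y -> S (x * y).

Record submonoid (M : monoidType) := Submonoid {
  submonoid_set :> set M;
  submonoidP : is_submonoid submonoid_set
}.

Lemma submonoid_inj (M : monoidType) : injective (@submonoid_set M).
Proof.
by move=> [S hS] [T hT] /= eST; case: _ / eST hT => hT; rewrite (Prop_irrelevance hS hT).
Qed.

HB.instance Definition _ (M : monoidType) := gen_eqMixin (submonoid M).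
HB.instance Definition _ (M : monoidType) := gen_choiceMixin (submonoid M).

Fact submonoid_display : Order.disp_t.
Proof. exact: (Order.Disp tt tt). Qed.

Section Generation.
Variable M : monoidType.
Implicit Types (A : set M) (S T : submonoid M).

Lemma generated_subproof A : is_submonoid (smallest (@is_submonoid M) A).
Proof.
split=> [S [[]]|x y hx hy S hS] //; case: (hS) => -[_ hM] _.
by apply: hM; [apply: hx | apply: hy].
Qed.

Definition generated A : submonoid M := Submonoid (generated_subproof A).

Lemma sub_generated A : A `<=` generated A.
Proof. exact: sub_gen_smallest. Qed.

Lemma generated_sub A S : A `<=` S -> generated A `<=` S.
Proof. by move=> AS x; apply; split=> //; apply: submonoidP. Qed.

Lemma submonoid_meet_subproof S T : is_submonoid (S `&` T).
Proof.
case: (submonoidP S) (submonoidP T) => [S1 SM] [T1 TM].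
by split=> // x y [Sx Tx] [Sy Ty]; split; [apply: SM | apply: TM].
Qed.

Definition submonoid_meet S T : submonoid M :=
  Submonoid (submonoid_meet_subproof S T).

Definition submonoid_join S T : submonoid M := generated (S `|` T).

Definition submonoid_le S T : bool := `[< S `<=` T >].

Lemma submonoid_le_refl : reflexive submonoid_le.
Proof. by move=> S; apply/asboolP. Qed.

Lemma submonoid_le_anti : antisymmetric submonoid_le.
Proof.
move=> S T /andP[/asboolP ST /asboolP TS].
by apply: submonoid_inj; apply/seteqP.
Qed.

Lemma submonoid_le_trans : transitive submonoid_le.
Proof.
move=> T S U /asboolP ST /asboolP TU.
by apply/asboolP; apply: subset_trans TU.
Qed.

HB.instance Definition _ := Order.Le_isPOrder.Build submonoid_display
  (submonoid M) submonoid_le_refl submonoid_le_anti submonoid_le_trans.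

Lemma lexI_submonoid (S T U : submonoid M) :
  (S <= submonoid_meet T U)%O = (S <= T)%O && (S <= U)%O.
Proof.
apply/asboolP/andP => [h|[/asboolP hT /asboolP hU] x Sx]; last first.
  by split; [apply: hT | apply: hU].
by split; apply/asboolP => x /h [].
Qed.

Lemma leUx_submonoid (S T U : submonoid M) :
  (submonoid_join S T <= U)%O = (S <= U)%O && (T <= U)%O.
Proof.
apply/asboolP/andP => [h|[/asboolP hS /asboolP hT]].
  by split; apply/asboolP => x hx; apply: h; apply: sub_generated; [left | right].
by apply: generated_sub => x []; [apply: hS | apply: hT].
Qed.

HB.instance Definition _ := Order.POrder_MeetJoin_isLattice.Build
  submonoid_display (submonoid M) lexI_submonoid leUx_submonoid.

End Generation.

Section Lattice_L.
Variable M : monoidType.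

Lemma trivial_submonoid_subproof : is_submonoid [set (1 : M)].
Proof. by split=> // x y /= -> ->; rewrite mulg1. Qed.
Definition OO : submonoid M := Submonoid trivial_submonoid_subproof.

Lemma full_submonoid_subproof : is_submonoid [set: M].
Proof. by []. Qed.
Definition II : submonoid M := Submonoid full_submonoid_subproof.

Definition EE : submonoid M := generated [set e : M | e * e = e].

Definition left_unit (x : M) : Prop := exists a, a * x = 1.
Definition right_unit (x : M) : Prop := exists a, x * a = 1.

Lemma left_units_subproof : is_submonoid left_unit.
Proof.
split=> [|x y [a ax] [b by1]]; first by exists 1; rewrite mulg1.
by exists (b * a); rewrite -mulgA (mulgA a) ax mul1g.
Qed.
Definition GGL : submonoid M := Submonoid left_units_subproof.

Lemma right_units_subproof : is_submonoid right_unit.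
Proof.
split=> [|x y [a xa] [b yb]]; first by exists 1; rewrite mulg1.
by exists (b * a); rewrite -mulgA (mulgA y) yb mul1g.
Qed.
Definition GGR : submonoid M := Submonoid right_units_subproof.

Definition GG : submonoid M := (GGL `&` GGR)%O.
Definition GGLR : submonoid M := generated (GGL `|` GGR).
Definition FF : submonoid M := generated (EE `|` GG).
Definition FFL : submonoid M := generated (EE `|` GGL).
Definition FFR : submonoid M := generated (EE `|` GGR).
Definition FFLR : submonoid M := generated (EE `|` GGL `|` GGR).

Definition LL : set (submonoid M) :=
  [set` [:: OO; EE; GG; GGL; GGR; GGLR; FF; FFL; FFR; FFLR; II]].

Definition LL_type := set_type LL.
HB.instance Definition _ := SubChoice.on LL_type.
HB.instance Definition _ :=
  [SubChoice_isSubPOrder of LL_type by <: with submonoid_display].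

End Lattice_L.

Arguments OO M : clear implicits.
Arguments EE M : clear implicits.
Arguments GG M : clear implicits.
Arguments GGL M : clear implicits.
Arguments GGR M : clear implicits.
Arguments GGLR M : clear implicits.
Arguments FF M : clear implicits.
Arguments FFL M : clear implicits.
Arguments FFR M : clear implicits.
Arguments FFLR M : clear implicits.
Arguments II M : clear implicits.
Arguments LL M : clear implicits.
Arguments LL_type M : clear implicits.

Definition join_subsemilattice (d : Order.disp_t) (T : joinSemilatticeType d)
    (A : set T) : Prop :=
  A !=set0 /\ forall x y, A x -> A y -> A (x `|` y)%O.

Definition is_lattice (d : Order.disp_t) (P : porderType d) : Prop :=
  forall x y : P,
    infimums [set x; y] !=set0 /\ supremums [set x; y] !=set0.

(* Main.v *)
Require Import Defs.
From mathcomp Require Import all_boot all_order.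
From mathcomp Require Import boolp classical_sets cardinality.

(** Every member of the list other than the full monoid is a join of some of
    the four submonoids [EE], [GG], [GGL], [GGR]: the submonoid generated by a
    union is the join, and the empty join is the trivial submonoid.  Conversely
    every such join is in the list, because [GG] lies below [GGL] and [GGR], so
    that the sixteen subsets of the four generators give at most ten joins
    ([generator_join_in_LL]).  The join of two such joins is the join over the
    union of the two subsets ([generator_joinU]), and the full monoid absorbs
    everything, so the list is closed under joins.

    The lattice property is then order theory: in a finite join-closed set with
    a least element, the meet of two elements is the join of their common lower
    bounds in the set ([finite_join_closed_glb]).  This meet need not be the
    intersection of the two submonoids: for the product of the bicyclic monoid
    [B] with the monoid of elements 0 and 1 under multiplication, the
    intersection of [EE] and [GGLR] is E(B) x {1}, which is not in the list. *)

Import Order.TTheory.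
Local Open Scope order_scope.

(** The witness is the join of all elements of [s] below both [x] and [y],
    accumulated along the list; the least element [o] is the starting value. *)
Lemma finite_join_closed_glb (d : Order.disp_t) (T : joinSemilatticeType d)
    (s : seq T) (o : T) :
  o \in s -> {in s, forall z, o <= z} ->
  {in s &, forall x y, x `|` y \in s} ->
  {in s &, forall x y, exists m, [/\ m \in s, m <= x, m <= y &
    {in s, forall z, z <= x -> z <= y -> z <= m}]}.
Proof.
move=> os ole joinS x y xs ys.
(* Induct on the part of s whose elements are dominated by m; m itself may be
   any element of s. *)
suff H (t : seq T) : {subset t <= s} ->
    exists m, [/\ m \in s, m <= x, m <= y &
      {in t, forall z, z <= x -> z <= y -> z <= m}] by exact: H.
elim: t => [_|u t IHt uts]; first by exists o; split; rewrite ?ole.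
have us : u \in s by apply: uts; rewrite mem_head.
have [|m [ms mx my mt]] := IHt; first by move=> z zt; rewrite uts ?in_cons ?zt ?orbT.
have [/andP[ux uy]|uxy] := boolP ((u <= x) && (u <= y)).
  exists (u `|` m); split; rewrite ?joinS ?leUx ?ux ?uy //.
  move=> z; rewrite in_cons => /predU1P[->|zt] zx zy; first exact: leUl.
  by rewrite (le_trans (mt z zt zx zy)) ?leUr.
exists m; split=> // z; rewrite in_cons => /predU1P[->|zt] zx zy; last exact: mt.
by rewrite zx zy in uxy.
Qed.

Section GeneratorJoins.
Variable M : monoidType.
Implicit Types (S T : submonoid M) (a b e g l r : bool).

Lemma OO_le S : OO M <= S.
Proof. by apply/asboolP => x /= ->; case: (submonoidP S). Qed.

Lemma le_II S : S <= II M.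
Proof. exact/asboolP. Qed.

Lemma OO_join S : OO M `|` S = S.
Proof. exact/join_idPr/OO_le. Qed.

Lemma join_OO S : S `|` OO M = S.
Proof. by rewrite joinC OO_join. Qed.

Lemma FFLR_joinE : FFLR M = EE M `|` (GGL M `|` GGR M).
Proof.
rewrite joinA; apply/eqP; rewrite eq_le; apply/andP; split; last first.
  by rewrite !leUx; apply/andP; split; first apply/andP; try split;
    apply/asboolP => x xS; apply: sub_generated; [left; left|left; right|right].
apply/asboolP/generated_sub => x [xS|xR].
  by apply: sub_generated; left; apply: sub_generated.
by apply: sub_generated; right.
Qed.

Lemma LL_joinE : LL M = [set` [:: OO M; EE M; GG M; GGL M; GGR M;
  GGL M `|` GGR M; EE M `|` GG M; EE M `|` GGL M; EE M `|` GGR M;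
  EE M `|` (GGL M `|` GGR M); II M]%O]%classic.
Proof. by rewrite -FFLR_joinE. Qed.

Definition generator_if a S := if a then S else OO M.

Lemma generator_ifU S a b :
  generator_if a S `|` generator_if b S = generator_if (a || b) S.
Proof. by case: a b => [] []; rewrite /= ?joinxx ?join_OO ?OO_join. Qed.

Definition generator_join e g l r : submonoid M :=
  generator_if e (EE M) `|` (generator_if g (GG M) `|`
    (generator_if l (GGL M) `|` generator_if r (GGR M))).

Lemma generator_joinU e g l r e' g' l' r' :
  generator_join e g l r `|` generator_join e' g' l' r' =
  generator_join (e || e') (g || g') (l || l') (r || r').
Proof.
rewrite /generator_join (joinACA (generator_if e _)).
rewrite (joinACA (generator_if g _)) (joinACA (generator_if l _)).
by rewrite !generator_ifU.
Qed.

(** The inclusions of [GG] in [GGL] and in [GGR] make the choice of [g]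
    immaterial as soon as [l] or [r] holds. *)
Lemma generator_join_in_LL e g l r : LL M (generator_join e g l r).
Proof.
have GL : GG M `|` GGL M = GGL M by apply/join_idPr/leIl.
have GR : GG M `|` GGR M = GGR M by apply/join_idPr/leIr.
have GLR : GG M `|` (GGL M `|` GGR M) = GGL M `|` GGR M by rewrite joinA GL.
rewrite LL_joinE /= !inE /generator_join /generator_if.
by case: e g l r => [] [] [] [];
  rewrite ?(OO_join, join_OO, GL, GR, GLR) eqxx ?orbT.
Qed.

Lemma LL_generator_join S : LL M S ->
  S = II M \/ exists e g l r, S = generator_join e g l r.
Proof.
rewrite LL_joinE /= !inE.
case/predU1P => [->|].
  by right; exists false, false, false, false; rewrite /generator_join /= !OO_join.
case/predU1P => [->|].
  by right; exists true, false, false, false; rewrite /generator_join /= !join_OO.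
case/predU1P => [->|].
  by right; exists false, true, false, false; rewrite /generator_join /= OO_join !join_OO.
case/predU1P => [->|].
  by right; exists false, false, true, false; rewrite /generator_join /= !OO_join join_OO.
case/predU1P => [->|].
  by right; exists false, false, false, true; rewrite /generator_join /= !OO_join.
case/predU1P => [->|].
  by right; exists false, false, true, true; rewrite /generator_join /= !OO_join.
case/predU1P => [->|].
  by right; exists true, true, false, false; rewrite /generator_join /= !join_OO.
case/predU1P => [->|].
  by right; exists true, false, true, false; rewrite /generator_join /= OO_join join_OO.
case/predU1P => [->|].
  by right; exists true, false, false, true; rewrite /generator_join /= !OO_join.
case/predU1P => [->|].
  by right; exists true, false, true, true; rewrite /generator_join /= OO_join.
by move/eqP; left.
Qed.

Lemma LL_II : LL M (II M).
Proof. by rewrite /LL /= !inE eqxx !orbT. Qed.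

Lemma LL_OO : LL M (OO M).
Proof. by rewrite /LL /= !inE eqxx. Qed.

Lemma LL_join S T : LL M S -> LL M T -> LL M (S `|` T).
Proof.
case/LL_generator_join => [->|[e [g [l [r ->]]]]].
  by rewrite (join_idPl (le_II T)) => _; exact: LL_II.
case/LL_generator_join => [->|[e' [g' [l' [r' ->]]]]].
  by rewrite (join_idPr (le_II _)); exact: LL_II.
by rewrite generator_joinU; exact: generator_join_in_LL.
Qed.

Lemma LL_type_lattice : is_lattice (LL_type M).
Proof.
move=> x y; have [xL yL] : LL M (val x) /\ LL M (val y).
  by split; apply: set_mem; apply: valP.
have [||m [mL mx my mP]] := finite_join_closed_glb _ _ _ (OO M) LL_OO _ _ _ _ xL yL.
- by move=> z _; exact: OO_le.
- by move=> S T; exact: LL_join.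
split.
  exists (Sub m (mem_set mL) : LL_type M); split=> [z [] ->|z zxy] //.
  have zx : z <= x by apply: zxy; left.
  have zy : z <= y by apply: zxy; right.
  by apply: mP zx zy; apply: set_mem; apply: valP z.
exists (Sub (val x `|` val y) (mem_set (LL_join _ _ xL yL)) : LL_type M).
split=> [z [] ->|z zxy]; [exact: leUl|exact: leUr|].
have xz : x <= z by apply: zxy; left.
have yz : y <= z by apply: zxy; right.
by change (val x `|` val y <= val z); rewrite leUx; apply/andP.
Qed.

End GeneratorJoins.

Theorem proposition2p3 (M : monoidType) :
  [/\ finite_set (LL M),
      join_subsemilattice (LL M),
      LL M (II M) /\ II M = [set: M]%classic :> set M
        /\ (forall S : submonoid M, LL M S -> (S <= II M)%O),
      LL M (OO M) /\ OO M = [set 1%g]%classic :> set M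
        /\ (forall S : submonoid M, LL M S -> (OO M <= S)%O)
    & is_lattice (LL_type M)].
Proof.
split; first exact: finite_seq.
- by split; [exists (OO M); exact: LL_OO|exact: LL_join].
- by split; [exact: LL_II|split=> // S _; exact: le_II].
- by split; [exact: LL_OO|split=> // S _; exact: OO_le].
- exact: LL_type_lattice.
Qed.
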